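(* Let $\mathcal{A}$ be a finite alphabet, let $\Omega\subseteq\mathcal{A}^{\mathbb{N}}$ be a shift space, let $l\ge 2$ be an integer, and let $\mathsf{X}_\Omega^{(l)}$ be the associated multiplicative subshift. The following are equivalent. (1) $\Omega$ is weakly mixing. (2) $\mathsf{X}_\Omega^{(l)}$ is $l$-directional mixing. (3) $\mathsf{X}_\Omega^{(l)}$ is $l^n$-directional mixing for every $n\in\mathbb{N}$. (4) $\mathsf{X}_\Omega^{(l)}$ is $l^n$-directional mixing for some $n\in\mathbb{N}$. Furthermore, if $l$ is a prime number, then the following is also equivalent to each of the conditions (1), (2), (3) and (4). (5) $\mathsf{X}_\Omega^{(l)}$ is $L$-directional mixing for every integer $L>1$.
   Context: $\mathbb{N}=\{1,2,\ldots\}$, $\mathbb{N}_0=\mathbb{N}\cup\{0\}$, and $[i,j]=\{n\in\mathbb{N}: i\le n\le j\}$. A shift space $\Omega\subseteq\mathcal{A}^{\mathbb{N}}$ (one-sided) is a closed set with $\sigma(\Omega)\subseteq\Omega$, where $(\sigma x)_i=x_{i+1}$. $B(\Omega)$ is the set of all admissible words of $\Omega$ (finite words of length $\ge 1$ occurring in elements of $\Omega$), and $|u|$ is the length of $u$. $\Omega$ is weakly mixing if for all $u_1,u_2,v_1,v_2\in B(\Omega)$ there exist $m\in\mathbb{N}$ and $x^{(1)},x^{(2)}\in\Omega$ such that $x^{(i)}|_{[1,|u_i|]}=u_i$ and $x^{(i)}|_{[|u_i|+m+1,|u_i|+m+|v_i|]}=v_i$ for $i=1,2$. The multiplicative subshift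 is $\mathsf{X}_\Omega^{(l)}=\{x=(x_k)_{k\ge1}\in\mathcal{A}^{\mathbb{N}} : (x_{i l^{n-1}})_{n\in\mathbb{N}}\in\Omega \text{ for all } i\in\mathbb{N}\}$. For $q\in\mathbb{N}$, $\Pi_q$ is defined by $(\Pi_q x)_i=x_{qi}$. $B(\mathsf{X}_\Omega^{(l)})$ is the set of admissible words $u=x|_{[1,n]}$ with $x\in\mathsf{X}_\Omega^{(l)}$ and $n\ge1$; here $|u|=n$ and the support of $u$ is $s(u)=[1,n]$. For an integer $q>1$, $\mathsf{X}_\Omega^{(l)}$ is $q$-directional mixing if for all $u,v\in B(\mathsf{X}_\Omega^{(l)})$ there exists $k\in\mathbb{N}_0$ such that for any $\alpha\in\mathbb{N}\setminus q\mathbb{N}$ there exists $x\in\mathsf{X}_\Omega^{(l)}$ satisfying $x|_{s(u)}=u$ and $(\Pi_{|u|\alpha q^k}x)|_{s(v)}=v$. *)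

(* Defs.v *)
From mathcomp Require Import all_boot all_classical topology.

Set Implicit Arguments.
Unset Strict Implicit.
Unset Printing Implicit Defensive.

Local Open Scope classical_set_scope.

(* Sequences (x_k)_{k >= 1} over A.  They are stored as functions on nat with
   the term x_k in position k - 1, so that no junk position 0 exists; [coord]
   and [mkseq1] convert to and from the 1-based indexing, and everything below
   is written with the latter. *)
Definition config (A : finType) : Type := nat -> A.

(* x_k, meaningful for k >= 1 only *)
Definition coord (A : finType) (x : config A) (k : nat) : A := x k.-1.

(* the sequence (f k)_{k >= 1}; the value f 0 is ignored *)
Definition mkseq1 (A : finType) (f : nat -> A) : config A := fun k => f k.+1.

(* x|_[a, b] as a word, for 1 <= a *)
Definition restr (A : finType) (x : config A) (a b : nat) : seq A :=
  [seq coord x k | k <- index_iota a b.+1].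

Definition shift_map (A : finType) (x : config A) : config A :=
  mkseq1 (fun i => coord x i.+1).

(* The empty set is not excluded. *)
Definition shift_space (A : finType) (Omega : set (config A)) : Prop :=
  closed (Omega : set {ptws nat -> discrete_topology A}) /\
  @shift_map A @` Omega `<=` Omega.

Definition language (A : finType) (Omega : set (config A)) : set (seq A) :=
  [set u | exists x a b, [/\ Omega x, 1 <= a, a <= b & restr x a b = u]].

Definition weakly_mixing (A : finType) (Omega : set (config A)) : Prop :=
  forall u1 u2 v1 v2 : seq A,
    language Omega u1 -> language Omega u2 ->
    language Omega v1 -> language Omega v2 ->
  exists (m : nat) (x1 x2 : config A),
    [/\ 1 <= m, Omega x1, Omega x2,
        restr x1 1 (size u1) = u1 /\
        restr x1 (size u1 + m + 1) (size u1 + m + size v1) = v1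
      & restr x2 1 (size u2) = u2 /\
        restr x2 (size u2 + m + 1) (size u2 + m + size v2) = v2].

Definition mult_subshift (A : finType) (Omega : set (config A)) (l : nat) :
    set (config A) :=
  [set x | forall i, 1 <= i ->
     Omega (mkseq1 (fun n => coord x (i * l ^ n.-1)))].

Definition dilation (A : finType) (q : nat) (x : config A) : config A :=
  mkseq1 (fun i => coord x (q * i)).

(* Admissible words of a multiplicative subshift: initial words only, as
   these sets are not shift-invariant. *)
Definition prefix_language (A : finType) (X : set (config A)) : set (seq A) :=
  [set u | exists x n, [/\ X x, 1 <= n & restr x 1 n = u]].

(* only used for q > 1 *)
Definition directional_mixing (A : finType) (q : nat) (X : set (config A)) :
    Prop :=
  forall u v : seq A, prefix_language X u -> prefix_language X v ->
  exists k : nat, forall alpha : nat, 1 <= alpha -> ~~ (q %| alpha) ->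
  exists x : config A,
    [/\ X x, restr x 1 (size u) = u
      & restr (dilation (size u * alpha * q ^ k) x) 1 (size v) = v].

(* Main.v *)
(* A point of the multiplicative subshift is an independent choice, for each root
   c not divisible by l, of a point of Omega along the chain c l^k.  Asking
   for u and for a dilated copy of v thus amounts to finitely many simultaneous
   transitions in Omega, one for each chain of v, after times that differ by
   bounded offsets as long as alpha is not divisible by l^n; weak mixing provides
   these by Furstenberg's intersection lemma.  Conversely two chains, of roots 1
   and l + 1, recover weak mixing. *)
Require Import Defs.
From mathcomp Require Import all_boot all_classical topology.
From mathcomp Require Import zify.

Set Implicit Arguments.
Unset Strict Implicit.
Unset Printing Implicit Defensive.

Local Open Scope classical_set_scope.

(** * Writing n as c * l ^ e with c not divisible by l *)

Definition lval (l n : nat) : nat := \max_(e < n | l ^ e %| n) e.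

Definition lroot (l n : nat) : nat := n %/ l ^ lval l n.

Lemma ndvdn_gt0 l c : ~~ (l %| c) -> 0 < c.
Proof. by case: c => //; rewrite dvdn0. Qed.

Lemma lvalM l c e : 1 < l -> ~~ (l %| c) -> lval l (c * l ^ e) = e.
Proof.
move=> l1 lc; have c0 := ndvdn_gt0 lc; apply/eqP; rewrite eqn_leq; apply/andP; split.
  apply/bigmax_leqP => -[i _] /=; rewrite leqNgt; apply: contraL => ei.
  rewrite -(subnKC ei) addSnnS expnD [c * _]mulnC dvdn_pmul2l ?expn_gt0 ?(ltnW l1) //.
  by apply: contra lc; apply: dvdn_trans; rewrite expnS dvdn_mulr.
(* The range [e < n] in [lval] is wide enough because [e < l ^ e]. *)
have lt_e : e < c * l ^ e.
  by apply: leq_trans (ltn_expl e l1) _; rewrite leq_pmull.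
by rewrite (bigmax_sup (Ordinal lt_e)) //= dvdn_mull.
Qed.

Lemma lrootM l c e : 1 < l -> ~~ (l %| c) -> lroot l (c * l ^ e) = c.
Proof. by move=> l1 lc; rewrite /lroot lvalM // mulnK // expn_gt0 ltnW. Qed.

Lemma root_val_inj l c d e f : 1 < l -> ~~ (l %| c) -> ~~ (l %| d) ->
  c * l ^ e = d * l ^ f -> c = d /\ e = f.
Proof.
by move=> l1 lc ld E; split; [rewrite -(lrootM e l1 lc) | rewrite -(lvalM e l1 lc)];
  rewrite E ?lrootM ?lvalM.
Qed.

Lemma root_val_ex l n : 1 < l -> 0 < n ->
  exists c e, n = c * l ^ e /\ ~~ (l %| c).
Proof.
move=> l1; elim/ltn_ind: n => n IH n0.
have [/dvdnP[m nE]|ln] := boolP (l %| n); last by exists n, 0; rewrite muln1.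
have m0 : 0 < m by move: n0; rewrite nE muln_gt0 => /andP[].
have [c [e [mE lc]]] := IH m (leq_trans (ltn_Pmulr l1 m0) (eq_leq (esym nE))) m0.
by exists c, e.+1; rewrite nE mE expnS; split=> //; rewrite -mulnA (mulnC l).
Qed.

(* For composite l the multiplicity of l is not additive; still, some prime p
   occurs less often in d than in l, and its multiplicity bounds a. *)
Lemma dvdn_expMr_bound l d m a : 0 < l -> 0 < m -> ~~ (l %| d) ->
  l ^ a %| m * d -> a <= m.
Proof.
move=> l0 m0 ld ladm; have d0 := ndvdn_gt0 ld.
have [p pl] : exists p, logn p d < logn p l.
  apply: contrapT => H; move/negP: ld; apply; apply/(dvdn_partP _ l0) => p.
  rewrite mem_primes p_part => /andP[pp _]; rewrite pfactor_dvdn // leqNgt.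
  by apply/negP => pl; apply: H; exists p.
have := dvdn_leq_log p _ ladm; rewrite muln_gt0 m0 d0 => /(_ isT).
rewrite lognX lognM //; have := ltn_logl p m0; nia.
Qed.

(** * Words and points, read from position 0 *)

Section Mixing.
Variable A : finType.
Implicit Types (x y z : config A) (Omega : set (config A)).

Lemma restrE x a n :
  restr x a.+1 (a + n) = mkseq (fun i => x (a + i)) n.
Proof.
rewrite /restr /index_iota subSS addKn /mkseq.
by rewrite -[a.+1]addn0 iotaDl -map_comp; apply: eq_map => i /=; rewrite /coord addSn.
Qed.

Lemma restr1E x n : restr x 1 n = mkseq x n.
Proof. by rewrite (restrE x 0). Qed.

Lemma eq_mkseqP (T : Type) (f g : nat -> T) n :
  mkseq f n = mkseq g n <-> forall i, i < n -> f i = g i.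
Proof.
split=> [E i ltin|E].
  by rewrite -(nth_mkseq (f 0) f ltin) E nth_mkseq.
by apply/eq_in_map => i; rewrite mem_iota => /andP[_]; exact: E.
Qed.

Definition shift_stable Omega := forall x a, Omega x -> Omega (fun k => x (a + k)).

Lemma shift_space_stable Omega : shift_space Omega -> shift_stable Omega.
Proof.
move=> [_ sO] x a; elim: a => [|a IH] Ox; first exact: Ox.
have <- : shift_map (fun k => x (a + k)) = (fun k => x (a.+1 + k)).
  by apply/funext => k; rewrite /shift_map /mkseq1 /coord /= addnS addSn.
by apply: sO; exists (fun k => x (a + k)) => //; exact: IH.
Qed.

Lemma languageP Omega u : shift_stable Omega -> language Omega u <->
  exists x, [/\ Omega x, 0 < size u & u = mkseq x (size u)].
Proof.
move=> sO; split=> [[x [a [b [Ox + + <-]]]]|[x [Ox u0 uE]]]; last first.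
  by exists x, 1, (size u); rewrite restr1E.
case: a => // a _ ab; rewrite -(subnKC (ltnW ab)) restrE size_mkseq.
by exists (fun k => x (a + k)); split; rewrite ?subn_gt0 //; exact: sO.
Qed.

(** * Simultaneous transfers between cylinders *)

Definition hits Omega p x y N := exists z,
  [/\ Omega z, forall b, b < p -> z b = x b
    & forall b, b < p -> z (N + b) = y b].

(** Weak mixing for cylinders of one length [p]; the offsets allow for chains that are entered after
    different numbers of steps. *)
Definition transfers Omega := forall x1 x2 y1 y2 p a1 a2,
  Omega x1 -> Omega x2 -> Omega y1 -> Omega y2 ->
  exists N, hits Omega p x1 y1 (N + a1) /\ hits Omega p x2 y2 (N + a2).

Lemma wm_transfers Omega : shift_stable Omega ->
  weakly_mixing Omega -> transfers Omega.
Proof.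
move=> sO wm x1 x2 y1 y2 p a1 a2 Ox1 Ox2 Oy1 Oy2.
have lang x n : Omega x -> language Omega (mkseq x n.+1).
  by move=> Ox; apply/languageP => //; exists x; rewrite size_mkseq.
(* Lengthening the source words by [a1] and [a2] turns the common gap [m] into the offset times; one
   more letter keeps every word nonempty. *)
have [m [z1 [z2 [_ Oz1 Oz2]]]] := wm _ _ _ _ (lang x1 (p + a1) Ox1)
  (lang x2 (p + a2) Ox2) (lang y1 p Oy1) (lang y2 p Oy2).
rewrite !size_mkseq !addn1 !restr1E !restrE.
move=> [/eq_mkseqP zx1 /eq_mkseqP zy1] [/eq_mkseqP zx2 /eq_mkseqP zy2].
exists (p.+1 + m); split; [exists z1|exists z2]; split=> // b bp.
- by apply: zx1; rewrite ltnS (leq_trans (ltnW bp)) ?leq_addr.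
- rewrite (_ : p.+1 + m + a1 = (p + a1).+1 + m); last by rewrite addnAC.
  by apply: zy1; exact: ltnW.
- by apply: zx2; rewrite ltnS (leq_trans (ltnW bp)) ?leq_addr.
- rewrite (_ : p.+1 + m + a2 = (p + a2).+1 + m); last by rewrite addnAC.
  by apply: zy2; exact: ltnW.
Qed.

(* Furstenberg's intersection lemma: the transfer times of one suitable pair of
   cylinders are transfer times of all the given pairs, up to offsets. *)
Lemma transfers_inter Omega (I : eqType) (s : seq I) (a : I -> nat)
    (X Y : I -> config A) p x0 :
  shift_stable Omega -> transfers Omega -> Omega x0 ->
  {in s, forall i, Omega (X i)} -> {in s, forall i, Omega (Y i)} ->
  exists q b x y, [/\ Omega x, Omega y & forall K, hits Omega q x y (K + b) ->
    {in s, forall i, hits Omega p (X i) (Y i) (K + a i)}].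
Proof.
move=> sO tr Ox0; elim: s => [|i s IH] OX OY; first by exists 0, 0, x0, x0.
have [||q [b [x [y [Ox Oy H]]]]] := IH.
- by move=> j js; apply: OX; rewrite inE js orbT.
- by move=> j js; apply: OY; rewrite inE js orbT.
(* [z] runs from [x] to [X i] and [w] from [y] to [Y i]. A point running from [z] to [w] still
   serves the old pairs, and read from time [N + b] it serves the new one. *)
have [||N [[z [Oz zx zX]] [w [Ow wy wY]]]] :=
  tr x y (X i) (Y i) (q + p) b (a i) Ox Oy.
- by apply: OX; rewrite mem_head.
- by apply: OY; rewrite mem_head.
exists (q + p + N + b + a i), b, z, w; split=> // K [h [Oh hz hw]] j.
rewrite inE => /predU1P[->{j}|js].
  exists (fun k => h (N + b + k)); split; first exact: sO.
  - by move=> c cp; rewrite hz ?zX //; lia.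
  - move=> c cp; rewrite (_ : N + b + _ = K + b + (N + a i + c)); last lia.
    by rewrite hw ?wY //; lia.
apply: H => //; exists h; split=> // c cq; [rewrite hz ?zx|rewrite hw ?wy] => //; lia.
Qed.

Lemma transfers_family Omega (I : eqType) (s : seq I) (a : I -> nat)
    (X Y : I -> config A) p x0 :
  shift_stable Omega -> transfers Omega -> Omega x0 ->
  {in s, forall i, Omega (X i)} -> {in s, forall i, Omega (Y i)} ->
  exists K, {in s, forall i, hits Omega p (X i) (Y i) (K + a i)}.
Proof.
move=> sO tr Ox0 OX OY.
have [q [b [x [y [Ox Oy H]]]]] := transfers_inter a p sO tr Ox0 OX OY.
by have [K [hK _]] := tr x x y y q b b Ox Ox Oy Oy; exists K; exact: H.
Qed.

(** A transfer from [y] to itself at time [N + a], with its first [N] terms dropped, leaves the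
    block of [y] at place [a]. *)
Lemma transfers_left_extension Omega y p a : shift_stable Omega ->
  transfers Omega -> Omega y ->
  exists z, Omega z /\ forall b, b < p -> z (a + b) = y b.
Proof.
move=> sO tr Oy; have [N [[z [Oz _ zy]] _]] := tr y y y y p a a Oy Oy Oy Oy.
by exists (fun k => z (N + k)); split=> [|b bp]; [exact: sO|rewrite addnA zy].
Qed.

(** * Recovering weak mixing from common transfer times *)

Lemma hits_words Omega p x y nu nv m : nu <= p -> nv <= p ->
  hits Omega p x y (nu + m) -> exists z, [/\ Omega z, restr z 1 nu = mkseq x nu
    & restr z (nu + m + 1) (nu + m + nv) = mkseq y nv].
Proof.
move=> up vp [z [Oz zx zy]]; exists z; rewrite addn1 restr1E restrE.
split=> //; apply/eq_mkseqP => i ilt; [apply: zx|apply: zy];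
  exact: leq_trans ilt _.
Qed.

(** This is what two chains yield directly. The bound [p <= N] makes the gap of weak mixing
    positive. *)
Definition double_hits Omega := forall x1 x2 y1 y2 p,
  Omega x1 -> Omega x2 -> Omega y1 -> Omega y2 ->
  exists N, [/\ p <= N, hits Omega p x1 y1 N & hits Omega p x2 y2 N].

(* Unequal word lengths shift one target by [d]; as [y2] has left extensions of
   every length, [double_hits] also covers that case. *)
Lemma double_hits_offset Omega x1 x2 y1 y2 p d :
  shift_stable Omega -> double_hits Omega ->
  Omega x1 -> Omega x2 -> Omega y1 -> Omega y2 ->
  exists N, [/\ p <= N, hits Omega p x1 y1 N & hits Omega p x2 y2 (N + d)].
Proof.
move=> sO dh Ox1 Ox2 Oy1 Oy2.
have [M [dM [z [Oz _ zy]] _]] := dh x1 x1 y2 y2 (p + d) Ox1 Ox1 Oy2 Oy2.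
have [|N [pN [w1 [Ow1 wx1 wy1]] [w2 [Ow2 wx2 wz2]]]] :=
  dh x1 x2 y1 (fun k => z (M - d + k)) (p + d) Ox1 Ox2 Oy1; first exact: sO.
exists N; split; first by lia.
- by exists w1; split=> // b bp; [apply: wx1|apply: wy1]; lia.
- exists w2; split=> // b bp; first by apply: wx2; lia.
  rewrite -addnA wz2; last by lia.
  by rewrite addnA subnK ?zy //; lia.
Qed.

Lemma double_hits_wm Omega : shift_stable Omega ->
  double_hits Omega -> weakly_mixing Omega.
Proof.
move=> sO dh u1 u2 v1 v2 /(languageP _ sO)[x1 [Ox1 _ u1E]]
  /(languageP _ sO)[x2 [Ox2 _ u2E]] /(languageP _ sO)[y1 [Oy1 _ v1E]]
  /(languageP _ sO)[y2 [Oy2 _ v2E]].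
pose p := (size u1 + size u2 + size v1 + size v2).+1.
suff [m [m0 h1 h2]] : exists m, [/\ 0 < m, hits Omega p x1 y1 (size u1 + m)
    & hits Omega p x2 y2 (size u2 + m)].
  have [||z1 [Oz1 zu1 zv1]] := hits_words (nv := size v1) _ _ h1; try lia.
  have [||z2 [Oz2 zu2 zv2]] := hits_words (nv := size v2) _ _ h2; try lia.
  by exists m, z1, z2; rewrite zu1 zu2 zv1 zv2 -u1E -u2E -v1E -v2E.
(* The gap is counted from the end of the shorter source word; the other hit comes later by the
   difference of lengths. *)
have [le12|/ltnW le21] := leqP (size u1) (size u2).
- have [N [pN h1 h2]] := double_hits_offset p (size u2 - size u1)
    sO dh Ox1 Ox2 Oy1 Oy2.
  exists (N - size u1); split; first by lia.
    by rewrite subnKC //; lia.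
  by rewrite (_ : _ + _ = N + (size u2 - size u1)) //; lia.
- have [N [pN h2 h1]] := double_hits_offset p (size u1 - size u2)
    sO dh Ox2 Ox1 Oy2 Oy1.
  exists (N - size u2); split; first by lia.
    by rewrite (_ : _ + _ = N + (size u1 - size u2)) //; lia.
  by rewrite subnKC //; lia.
Qed.

(** * Chains of the multiplicative subshift and gluing *)

Definition chain l x i : config A := fun k => coord x (i * l ^ k).

Definition assemble l (Z : nat -> config A) : config A :=
  mkseq1 (fun n => Z (lroot l n) (lval l n)).

Lemma chain_assemble l Z c k : 1 < l -> ~~ (l %| c) ->
  chain l (assemble l Z) c k = Z c k.
Proof.
move=> l1 lc; rewrite /chain /coord /assemble /mkseq1 prednK.
  by rewrite lrootM // lvalM.
by rewrite muln_gt0 (ndvdn_gt0 lc) expn_gt0 ltnW.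
Qed.

(** For [i = c * l ^ e] the sequence along [i] is a tail of the chain of the root [c], so shift
    stability reduces the condition to roots. *)
Lemma assemble_mult_subshift Omega l Z : shift_stable Omega -> 1 < l ->
  (forall c, ~~ (l %| c) -> Omega (Z c)) ->
  mult_subshift Omega l (assemble l Z).
Proof.
move=> sO l1 OZ i i0; have [c [e [-> lc]]] := root_val_ex l1 i0.
have -> : mkseq1 (fun n => coord (assemble l Z) (c * l ^ e * l ^ n.-1)) =
    (fun k => Z c (e + k)); last exact/sO/OZ.
by apply/funext => k; rewrite /mkseq1 /= -mulnA -expnD; exact: chain_assemble.
Qed.

Lemma coord_chain l x c k : coord x (c * l ^ k) = chain l x c k.
Proof. by []. Qed.

Lemma mult_subshift_chain Omega l x i :
  mult_subshift Omega l x -> 0 < i -> Omega (chain l x i).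
Proof. exact. Qed.

Lemma prefix_coordP x y n :
  (forall i, 0 < i <= n -> coord x i = coord y i) -> restr x 1 n = restr y 1 n.
Proof. by rewrite !restr1E => H; apply/eq_mkseqP => i lin; exact: (H i.+1). Qed.

Lemma dilation_coord q x i : 0 < i -> coord (dilation q x) i = coord x (q * i).
Proof. by case: i. Qed.

(* A chain of [x] meets at most one chain of the dilated copy of [v], so the
   chains of [x] can be chosen independently. *)
Lemma mult_subshift_glue Omega l D xu xv nu nv :
  shift_stable Omega -> 1 < l -> 0 < D ->
  mult_subshift Omega l xu -> mult_subshift Omega l xv ->
  (forall c r a, ~~ (l %| c) -> ~~ (l %| r) -> r <= nv -> D * r = c * l ^ a ->
     exists z, [/\ Omega z,
       c <= nu -> forall b, b < nu -> z b = chain l xu c b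
     & forall b, b < nv -> z (a + b) = chain l xv r b]) ->
  exists x, [/\ mult_subshift Omega l x, restr x 1 nu = restr xu 1 nu
    & restr (dilation D x) 1 nv = restr xv 1 nv].
Proof.
move=> sO l1 D0 Xu Xv H.
pose P c z := ~~ (l %| c) -> [/\ Omega z,
  c <= nu -> forall b, b < nu -> z b = chain l xu c b
  & forall r a, ~~ (l %| r) -> r <= nv -> D * r = c * l ^ a ->
      forall b, b < nv -> z (a + b) = chain l xv r b].
have [c|Z PZ] := @choice _ _ P.
  have [lc|lc] := boolP (l %| c); first by exists xu; rewrite /P lc.
  have c0 := ndvdn_gt0 lc.
  have [[r [a [lr rv E]]]|no] :=
    pselect (exists r a, [/\ ~~ (l %| r), r <= nv & D * r = c * l ^ a]).
    have [z [Oz zu zv]] := H c r a lc lr rv E.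
    exists z => _; split=> // r' a' lr' rv' E'.
    (* Two encounters of one chain with the copy of v have equal roots and exponents. *)
    have /(root_val_inj l1 lr lr')[<- ->] // : r * l ^ a' = r' * l ^ a.
    apply/eqP; rewrite -(eqn_pmul2l D0) !mulnA E E'; apply/eqP; lia.
  exists (chain l xu c) => _; split=> //; first exact: mult_subshift_chain.
  by move=> r a lr rv E; case: no; exists r, a.
exists (assemble l Z); split.
- by apply: assemble_mult_subshift => // c /PZ[].
- apply: prefix_coordP => i /andP[i0 iu].
  have [c [e [iE lc]]] := root_val_ex l1 i0.
  have c0 := ndvdn_gt0 lc.
  have le0 : 0 < l ^ e by rewrite expn_gt0 ltnW.
  (* From [e < l ^ e <= i <= nu], agreement on [nu] terms of each chain is enough. *)
  have elt := ltn_expl e l1.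
  rewrite iE !coord_chain chain_assemble //.
  by have [_ zu _] := PZ c lc; apply: zu; nia.
- apply: prefix_coordP => i /andP[i0 iv]; rewrite dilation_coord //.
  have [r [e [iE lr]]] := root_val_ex l1 i0.
  have r0 := ndvdn_gt0 lr.
  have le0 : 0 < l ^ e by rewrite expn_gt0 ltnW.
  have elt := ltn_expl e l1.
  have Dr0 : 0 < D * r by rewrite muln_gt0 D0.
  have [c [a [E lc]]] := root_val_ex l1 Dr0.
  rewrite iE mulnA E -mulnA -expnD !coord_chain chain_assemble //.
  by have [_ _ zv] := PZ c lc; apply: (zv r a) => //; nia.
Qed.

(** * Directional mixing against weak mixing *)

Lemma prefix_languageP X u : prefix_language X u ->
  exists x, [/\ X x, 0 < size u & u = restr x 1 (size u)].
Proof.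
by move=> [x [n [Xx n0 <-]]]; exists x; rewrite !restr1E size_mkseq.
Qed.

Lemma restr_coord x y n i : restr x 1 n = restr y 1 n -> 0 < i <= n ->
  coord x i = coord y i.
Proof. by rewrite !restr1E => /eq_mkseqP H; case: i => // i; exact: H. Qed.

(* The roots 1 and [l + 1] are prime to [l], and for [|u|] a power of [l] their
   chains in [u] are continued by the same chains of the dilated copy of [v]
   after the same number of steps. *)
Lemma directional_mixing_double_hits Omega l n : shift_stable Omega -> 1 < l ->
  0 < n -> directional_mixing (l ^ n) (mult_subshift Omega l) ->
  double_hits Omega.
Proof.
move=> sO l1 n0 dm x1 x2 y1 y2 p Ox1 Ox2 Oy1 Oy2.
have l0 := ltnW l1.
pose Z (s t : config A) c := if c == 1 then s else t.
have ln1 : ~~ (l %| 1) by rewrite dvdn1; lia.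
have lnl1 : ~~ (l %| l.+1) by rewrite -addn1 dvdn_addr.
pose xu := assemble l (Z x1 x2); pose xv := assemble l (Z y1 y2).
have X_Z s t : Omega s -> Omega t -> mult_subshift Omega l (assemble l (Z s t)).
  by move=> Os Ot; apply: assemble_mult_subshift => // c _; rewrite /Z; case: ifP.
(* As l + 1 <= l ^ 2, a prefix of this length holds the first [p] terms of both chains. *)
pose w := l ^ p.+2.
have w0 : 0 < w by rewrite expn_gt0 l0.
have pref s t : Omega s -> Omega t ->
    prefix_language (mult_subshift Omega l) (restr (assemble l (Z s t)) 1 w).
  by move=> Os Ot; exists (assemble l (Z s t)), w; split=> //; exact: X_Z.
have [k /(_ 1 isT)] := dm _ _ (pref x1 x2 Ox1 Ox2) (pref y1 y2 Oy1 Oy2).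
rewrite dvdn1 -[X in _ == X](expn0 l) eqn_exp2l // -lt0n n0 => /(_ isT).
rewrite !(restr1E (assemble _ _)) !size_mkseq -!restr1E muln1 -expnM -expnD.
move=> [x [Xx xu_eq xv_eq]].
have in_w r b : r <= l.+1 -> b < p -> r * l ^ b <= w.
  move=> rl bp; have lb : l ^ b.+2 <= w by rewrite leq_exp2l //; lia.
  by apply: leq_trans lb; rewrite !expnS mulnA leq_mul2r; apply/orP; right; nia.
have hitsZ r s t s' t' : 0 < r -> r <= l.+1 -> ~~ (l %| r) ->
    restr x 1 w = restr (assemble l (Z s t)) 1 w ->
    restr (dilation (l ^ (p.+2 + n * k)) x) 1 w =
      restr (assemble l (Z s' t')) 1 w ->
    hits Omega p (Z s t r) (Z s' t' r) (p.+2 + n * k).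
  move=> r0 rl lr xs xt; exists (chain l x r); split.
  - exact: mult_subshift_chain.
  - move=> b bp; rewrite -(chain_assemble (Z s t) b l1) // -!coord_chain.
    by apply: restr_coord xs _; rewrite muln_gt0 r0 expn_gt0 l0 in_w.
  - move=> b bp; have rb0 : 0 < r * l ^ b by rewrite muln_gt0 r0 expn_gt0 l0.
    rewrite -(chain_assemble (Z s' t') b l1) // -!coord_chain expnD mulnCA.
    by rewrite -dilation_coord //; apply: restr_coord xt _; rewrite rb0 in_w.
exists (p.+2 + n * k); split; first by lia.
- exact: (hitsZ 1 x1 x2 y1 y2).
- have := hitsZ l.+1 x1 x2 y1 y2 isT (leqnn _) lnl1 xu_eq xv_eq.
  by rewrite /Z eqSS -[l == 0]negbK -lt0n l0.
Qed.

(** The time has to be fixed before alpha. This is possible because only finitely many triples of an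
    offset and two roots matter, the offsets being bounded uniformly in alpha. *)
Lemma wm_directional_mixing_exp Omega l n : shift_stable Omega -> 1 < l ->
  0 < n -> weakly_mixing Omega ->
  directional_mixing (l ^ n) (mult_subshift Omega l).
Proof.
move=> sO l1 n0 /(wm_transfers sO) tr u v.
move=> /prefix_languageP[xu [Xu u0 uE]] /prefix_languageP[xv [Xv v0 vE]].
set nu := size u in u0 uE *; set nv := size v in v0 vE *.
have l0 := ltnW l1.
have ln0 : 0 < l ^ n by rewrite expn_gt0 l0.
pose B := (nu * nv).+1 * n.
pose s := [seq (a, cr) | a <- iota 0 (B + n).+1,
  cr <- [seq (c, r) | c <- iota 1 nu, r <- iota 1 nv]].
have mem_s a c r : a <= B + n -> 0 < c <= nu -> 0 < r <= nv -> (a, (c, r)) \in s.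
  by move=> aB cu rv; apply/allpairs_f; rewrite ?allpairs_f // mem_iota; lia.
have s_pos i : i \in s -> 0 < i.2.1 /\ 0 < i.2.2.
  move=> /allpairsP[[a cr] /= [_ /allpairsP[[c r] /= [+ + ->]] ->]] /=.
  by rewrite !mem_iota; lia.
have [i /s_pos[i1 _]|i /s_pos[_ i2]|K hK] := transfers_family (s := s) fst
  (X := fun i => chain l xu i.2.1) (Y := fun i => chain l xv i.2.2) (nu + nv)
  sO tr (mult_subshift_chain Xu (ltnSn 0)).
- exact: mult_subshift_chain.
- exact: mult_subshift_chain.
(* Offsets up to [B + n] instead of [B] leave room to move [K] to a multiple of
   [n]. *)
have [k [j [jn kE]]] : exists k j, j <= n /\ n * k = K + j.
  exists (K %/ n).+1, (n - K %% n); have := ltn_pmod K n0; have := divn_eq K n.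
  by split; lia.
exists k => alpha alpha0 lalpha.
have D0 : 0 < nu * alpha * (l ^ n) ^ k by rewrite !muln_gt0 u0 alpha0 expn_gt0 ln0.
rewrite uE vE; apply: mult_subshift_glue => // c r a lc lr rv E.
have r0 := ndvdn_gt0 lr.
have nar0 : 0 < nu * alpha * r by rewrite !muln_gt0 u0 alpha0.
have [c' [a' [E' lc']]] := root_val_ex l1 nar0.
have {E}[cE aE] : c' = c /\ a' + n * k = a.
  apply: (root_val_inj l1 lc' lc); rewrite expnD mulnA -E' -E -expnM; lia.
have aB : a' <= B.
  (* [(l ^ n) ^ (a' %/ n)] divides [nu * r * alpha], while [l ^ n] does not divide [alpha]; this is
     the source of [B]. *)
  have : a' %/ n <= nu * r.
    apply: (dvdn_expMr_bound ln0 _ lalpha); first by rewrite muln_gt0 u0.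
    rewrite mulnAC E' -expnM dvdn_mull // dvdn_exp2l // mulnC; exact: leq_trunc_div.
  move=> /leq_trans/(_ (leq_mul (leqnn nu) rv)); rewrite -ltnS => lt_a'.
  by apply: ltnW; rewrite -ltn_divLR.
have c0 := ndvdn_gt0 lc.
(* For [c > nu] the word u asks nothing of the chain, and [minn] only keeps the index inside [s]. *)
have [|||z [Oz zu zv]] := hK (a' + j, (minn c nu, r)) (mem_s _ _ _ _ _ _).
- by lia.
- by lia.
- by rewrite r0.
exists z; split=> //= [cu b bu|b bv].
  by rewrite zu /= ?(minn_idPl cu) //; lia.
rewrite -zv /=; last by lia.
by rewrite -aE kE addnCA.
Qed.

(* If [L = M * l ^ e] with [M > 1] prime to [l], then for [M ^ k > |u|] the copy
   of [v] lies in chains whose roots exceed [|u|], whatever alpha is. *)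
Lemma wm_directional_mixing Omega l L : shift_stable Omega -> prime l ->
  1 < L -> weakly_mixing Omega -> directional_mixing L (mult_subshift Omega l).
Proof.
move=> sO lp L1 wm; have l1 := prime_gt1 lp.
have [M [e [LE lM]]] := root_val_ex l1 (ltnW L1).
have M0 := ndvdn_gt0 lM.
have [M1|M1] := eqVneq M 1.
  rewrite LE M1 mul1n; apply: wm_directional_mixing_exp => //.
  by case: e LE => [|//] LE; move: L1; rewrite LE M1.
have {}M1 : 1 < M by rewrite ltn_neqAle eq_sym M1.
have tr := wm_transfers sO wm.
move=> u v /prefix_languageP[xu [Xu u0 uE]] /prefix_languageP[xv [Xv v0 vE]].
set nu := size u in u0 uE *; set nv := size v in v0 vE *.
exists nu => alpha alpha0 _.
have D0 : 0 < nu * alpha * L ^ nu.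
  by rewrite !muln_gt0 u0 alpha0 expn_gt0 (ltnW L1).
rewrite uE vE; apply: mult_subshift_glue => // c r a lc lr rv E.
have r0 := ndvdn_gt0 lr.
have nar0 : 0 < nu * alpha * r by rewrite !muln_gt0 u0 alpha0.
have [c' [a' [E' lc']]] := root_val_ex l1 nar0.
(* Primality of [l] makes a product of roots a root. *)
have lcM : ~~ (l %| c' * M ^ nu).
  by rewrite Euclid_dvdM // negb_or lc' Euclid_dvdX // negb_and lM.
have [cE _] : c' * M ^ nu = c /\ a' + e * nu = a.
  apply: (root_val_inj l1 lcM lc); rewrite -E expnD expnM mulnACA -E' -expnMn -LE.
  by rewrite mulnAC.
have nu_c : nu < c.
  by rewrite -cE; have := ltn_expl nu M1; have := ndvdn_gt0 lc'; nia.
(* With [c] beyond [nu], only the block of v must be placed on this chain. *)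
have [z [Oz zv]] := transfers_left_extension nv a sO tr
  (mult_subshift_chain Xv r0).
by exists z; split=> // cu; move: nu_c; rewrite ltnNge cu.
Qed.

End Mixing.

(** * The cycles of implications *)

Theorem theorem1p2 (A : finType) (Omega : set (config A)) (l : nat)
    (Omega_shift : shift_space Omega) (l_ge2 : 2 <= l) :
  [<-> weakly_mixing Omega;
       directional_mixing l (mult_subshift Omega l);
       forall n : nat, 1 <= n ->
         directional_mixing (l ^ n) (mult_subshift Omega l);
       exists n : nat, 1 <= n /\
         directional_mixing (l ^ n) (mult_subshift Omega l)]
  /\
  (prime l ->
   [<-> weakly_mixing Omega;
        directional_mixing l (mult_subshift Omega l);
        forall n : nat, 1 <= n ->
          directional_mixing (l ^ n) (mult_subshift Omega l);
        exists n : nat, 1 <= n /\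
          directional_mixing (l ^ n) (mult_subshift Omega l);
        forall L : nat, 1 < L ->
          directional_mixing L (mult_subshift Omega l)]).
Proof.
have sO := shift_space_stable Omega_shift.
have wm_of n : 0 < n -> directional_mixing (l ^ n) (mult_subshift Omega l) ->
    weakly_mixing Omega.
  by move=> n0 dm; exact/double_hits_wm/(directional_mixing_double_hits sO _ n0 dm).
have dm_of n : 0 < n -> weakly_mixing Omega ->
    directional_mixing (l ^ n) (mult_subshift Omega l).
  exact: wm_directional_mixing_exp.
have c12 : weakly_mixing Omega -> directional_mixing l (mult_subshift Omega l).
  exact: (dm_of 1).
have c23 : directional_mixing l (mult_subshift Omega l) ->
    forall n, 0 < n -> directional_mixing (l ^ n) (mult_subshift Omega l).
  by move=> /(wm_of 1 isT) wm n /dm_of; exact.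
have c34 : (forall n, 0 < n -> directional_mixing (l ^ n) (mult_subshift Omega l)) ->
    exists n, 1 <= n /\ directional_mixing (l ^ n) (mult_subshift Omega l).
  by move=> dm; exists 1; split=> //; exact: dm.
split=> [|lp]; tfae=> //.
- by move=> [n [n0]]; exact: wm_of.
- by move=> [n [n0 /(wm_of n n0) wm]] L L1; exact: wm_directional_mixing.
- by move=> dm; apply: (wm_of 1 isT); exact: dm.
Qed.
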